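(* There exists an infinite, three-generated lattice in $\mathbf{SUB}_3$. Hence $\mathbf{SUB}_n$ is not locally finite for $n\ge 3$.
   Context: For a poset $(P,\trianglelefteq)$, a subset $X\subseteq P$ is order-convex if $x\trianglelefteq z\trianglelefteq y$ and $\{x,y\}\subseteq X$ imply $z\in X$. $\mathbf{Co}(P)$ is the lattice of all order-convex subsets of $P$ under inclusion. The length of $P$ is the supremum of $|C|-1$ over finite subchains $C$ of $P$. For a positive integer $n$, $\mathbf{SUB}_n$ is the class of all lattices that can be embedded into $\mathbf{Co}(P)$ for some poset $P$ of length at most $n$. A class of lattices is locally finite if each of its finitely generated members is finite. *)

(* Defs.v *)
From HB Require Import structures.
From mathcomp Require Import all_boot all_order all_algebra.
From mathcomp Require Import finmap.
From mathcomp Require Import mathcomp_extra boolp classical_sets functions.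
From mathcomp Require Import cardinality constructive_ereal.

Set Implicit Arguments.
Unset Strict Implicit.
Unset Printing Implicit Defensive.

Import Order.TTheory GRing.Theory Num.Theory.
Local Open Scope classical_set_scope.

Definition order_convex d (P : porderType d) : set (set P) :=
  [set X | forall x y z : P,
     X x -> X y -> (x <= z)%O -> (z <= y)%O -> X z].

(* Membership is stated with \in because subType needs a boolean predicate. *)
Record Co d (P : porderType d) := MkCo {
  Co_set :> set P;
  Co_convex : Co_set \in @order_convex d P }.

Section CoLattice.
Context d (P : porderType d).

HB.instance Definition _ := [isSub for @Co_set d P].
HB.instance Definition _ := [Choice of Co P by <:].
HB.instance Definition _ :=
  [SubChoice_isSubPOrder of Co P by <: with set_display].

Lemma order_convexI (A B : set P) :
  order_convex A -> order_convex B -> order_convex (A `&` B).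
Proof.
move=> cA cB x y z [Ax Bx] [Ay By] xz zy.
by split; [apply: cA xz zy | apply: cB xz zy].
Qed.

Lemma order_convex_smallest (A : set P) :
  order_convex (smallest (@order_convex d P) A).
Proof.
move=> x y z Ax Ay xz zy M [cM AM].
exact: (cM x y z (Ax M (conj cM AM)) (Ay M (conj cM AM)) xz zy).
Qed.

Definition Co_meet (A B : Co P) : Co P :=
  MkCo (mem_set (order_convexI (set_mem (Co_convex A))
                               (set_mem (Co_convex B)))).

Definition Co_join (A B : Co P) : Co P :=
  MkCo (mem_set (@order_convex_smallest (A `|` B))).

Lemma Co_meetP (A B C : Co P) :
  (A <= Co_meet B C)%O = (A <= B)%O && (A <= C)%O.
Proof. by rewrite -!Order.le_val; exact: lexI. Qed.

Lemma Co_joinP (A B C : Co P) :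
  (Co_join A B <= C)%O = (A <= C)%O && (B <= C)%O.
Proof.
rewrite -!Order.le_val -leUx; apply/idP/idP => /subsetPset sC; apply/subsetPset.
  exact: subset_trans (@sub_gen_smallest _ _ _) sC.
by apply: smallest_sub sC; exact: set_mem (Co_convex C).
Qed.

HB.instance Definition _ :=
  Order.POrder_MeetJoin_isLattice.Build set_display (Co P) Co_meetP Co_joinP.

Lemma Co_leE (A B : Co P) : (A <= B)%O = (Co_set A `<=` Co_set B) :> Prop.
Proof. by rewrite -Order.le_val subsetEset. Qed.

Lemma Co_meetE (A B : Co P) : Co_set (A `&` B)%O = Co_set A `&` Co_set B.
Proof. by []. Qed.

Lemma Co_joinE (A B : Co P) :
  Co_set (A `|` B)%O = smallest (@order_convex d P) (Co_set A `|` Co_set B).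
Proof. by []. Qed.

End CoLattice.

Section Length.
Context d (P : porderType d).

Definition is_chain (C : {fset P}) := {in C &, forall x y, (x >=< y)%O}.

(* The empty chain counts, so the empty poset has length -1. The default    *)
(* value of supremum is never used: the set is nonempty, so it has either a *)
(* maximum in int or supremum +oo.                                          *)
Definition poset_length : \bar int :=
  supremum -oo%E
    [set ((#|` C|%fset : int) - 1)%R%:E | C in [set C | is_chain C]].

Lemma poset_length_le (n : nat) :
  (poset_length <= (n : int)%:E)%O <->
  forall C : {fset P}, is_chain C -> (#|` C|%fset <= n.+1)%N.
Proof.
rewrite /poset_length; set S := (X in supremum _ X).
pose v (k : nat) : \bar int := (((k : int) - 1)%R%:E).
have v_mono k m : (v k <= v m)%O = (k <= m)%N by rewrite lee_fin lerD2r.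
have vS n' : v n'.+1 = (n' : int)%:E by rewrite /v -addn1 PoszD addrK.
have Sub (b : \bar int) : ubound S b <->
    forall C : {fset P}, is_chain C -> (v #|` C|%fset <= b)%O.
  by split=> [Sb C cC | Sb _ [C cC <-]]; [apply: Sb; exists C | apply: Sb].
have ch0 : is_chain fset0 by move=> x y; rewrite inE.
have S0 : S !=set0 by exists (v 0%N); exists fset0; rewrite ?cardfs0.
have [l Sl] : supremums S !=set0.
  have [[b hb] | unb] := pselect (exists b : nat,
      forall C : {fset P}, is_chain C -> (#|` C|%fset <= b)%N).
    pose p k := `[< exists2 C : {fset P}, is_chain C & #|` C|%fset = k >].
    have exp : exists k, p k by exists 0%N; apply/asboolP; exists fset0; rewrite ?cardfs0.
    have pb k : p k -> (k <= b)%N by move=> /asboolP[C cC <-]; exact: hb.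
    case: (ex_maxnP exp pb) => m /asboolP[C cC Cm] mmax.
    exists (v m); split=> [|u /Sub/(_ C cC)]; last by rewrite Cm.
    by apply/Sub => D cD; rewrite v_mono; apply: mmax; apply/asboolP; exists D.
  exists +oo%E; split=> [u _|u /Sub ub]; first exact: leey.
  case: u ub => [z|//|] ub; exfalso; last by have := ub _ ch0.
  apply: unb; exists `|((z : int) + 1)%R|%N => C /ub; rewrite lee_fin lerBlDr -lez_nat.
  by move=> /le_trans; apply; rewrite abszE ler_norm.
have -> : supremum -oo%E S = l.
  rewrite /supremum ifF; last by apply/negbTE/set0P.
  by case: xgetP => [y _ Sy | /(_ l) //]; exact: is_subset1_supremums Sy Sl.
case: Sl => Sl lS; rewrite -vS; split=> [ln C cC | H].
  by rewrite -v_mono (le_trans _ ln)//; move: Sl => /Sub; apply.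
by apply: lS; apply/Sub => C cC; rewrite v_mono; exact: H.
Qed.

End Length.

Definition lattice_embedding d (L : latticeType d) d' (M : latticeType d')
    (f : L -> M) : Prop :=
  [/\ injective f, Order.meet_morphism f & Order.join_morphism f].

Definition lattice_class := forall d : Order.disp_t, latticeType d -> Prop.

Definition SUB (n : nat) : lattice_class := fun d L =>
  exists (d' : Order.disp_t) (P : porderType d') (f : L -> Co P),
    (poset_length P <= (n : int)%:E)%O /\ lattice_embedding f.

Definition sublattice d (L : latticeType d) (A : set L) : Prop :=
  forall x y, A x -> A y -> A (x `&` y)%O /\ A (x `|` y)%O.

Definition generates d (L : latticeType d) (G : set L) : Prop :=
  smallest (@sublattice d L) G = [set: L].

Definition finitely_generated d (L : latticeType d) : Prop :=
  exists2 G : set L, finite_set G & generates G.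

Definition three_generated d (L : latticeType d) : Prop :=
  exists a b c : L, generates [set a; b; c].

Definition locally_finite (K : lattice_class) : Prop :=
  forall (d : Order.disp_t) (L : latticeType d),
    K d L -> finitely_generated L -> finite_set [set: L].

(* Main.v *)
Require Import Defs.
From HB Require Import structures.
From mathcomp Require Import all_boot all_order.
From mathcomp Require Import finmap zify ssrint.
From mathcomp Require Import boolp classical_sets cardinality.
From mathcomp Require Import constructive_ereal.

(** The lattice is found inside Co(P) for the poset P made of an infinite fence
    w_0 > w_1 < w_2 > w_3 < ... together with a bottom p and a top q; its
    chains have at most four elements (p < odd node < even node < q).

    Take A = {p}, B = {q, w_0} and C = {w_0, w_1, ...}, three order-convex
    sets, and start from B /\ C = {w_0}. Joining a set X of nodes with A adds p and
    what lies between p and X, hence the odd nodes below a member of X; joining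
    with B adds, besides B, the even nodes above a member of X. So if
    X = {w_0, ..., w_k}, then w_{k+1} enters X \/ A when k is even, and X \/ B
    when k is odd, and no further node does. Meeting with C discards p and q.
    Alternating the two operations therefore produces {w_0, ..., w_k} for
    every k (lemma [climbE]): the sublattice generated by A, B, C is infinite.
    It embeds into Co(P) with P of length at most 3 ([fence_poset_length]), so
    it lies in SUB_n for every n >= 3, and being generated by three elements
    it refutes local finiteness for all these n at once. *)

Set Implicit Arguments.
Unset Strict Implicit.
Unset Printing Implicit Defensive.

Import Order.TTheory.
Local Open Scope classical_set_scope.

(** * The sublattice generated by a set *)

Section GeneratedSublattice.
Context d (L : latticeType d) (G : set L).

Definition generated : set L := smallest (@sublattice d L) G.

Lemma generated_sublattice : sublattice generated.
Proof.
move=> x y Gx Gy; split=> M [cM GM];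
  by have [] := cM x y (Gx M (conj cM GM)) (Gy M (conj cM GM)).
Qed.

Definition generated_pred : {pred L} := mem generated.

Lemma generated_meet_closed :
  {in generated_pred &, forall x y, (x `&` y)%O \in generated_pred}.
Proof.
move=> x y /set_mem Gx /set_mem Gy; apply/mem_set.
by have [] := generated_sublattice Gx Gy.
Qed.

Lemma generated_join_closed :
  {in generated_pred &, forall x y, (x `|` y)%O \in generated_pred}.
Proof.
move=> x y /set_mem Gx /set_mem Gy; apply/mem_set.
by have [] := generated_sublattice Gx Gy.
Qed.

Record generated_lattice := GeneratedLattice {
  gen_val :> L;
  gen_valP : gen_val \in generated_pred }.

HB.instance Definition _ := [isSub for gen_val].
HB.instance Definition _ := [Choice of generated_lattice by <:].
HB.instance Definition _ := Order.SubChoice_isSubLattice.Build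
  d L generated_pred d generated_lattice
  generated_meet_closed generated_join_closed.

Lemma gen_valI (x y : generated_lattice) :
  gen_val (x `&` y)%O = (gen_val x `&` gen_val y)%O.
Proof. by []. Qed.

Lemma gen_valU (x y : generated_lattice) :
  gen_val (x `|` y)%O = (gen_val x `|` gen_val y)%O.
Proof. by []. Qed.

(** The generators must generate the subtype as a lattice in its own right:
    a sublattice M of the subtype containing them has an image in L that is a
    sublattice containing G, so this image contains all that G generates. *)
Lemma generates_generated : generates (gen_val @^-1` G).
Proof.
apply/seteqP; split=> // x _ M [cM GM].
pose N := [set y | exists2 u, M u & gen_val u = y].
suff [u Mu /val_inj <- //] : N (gen_val x).
apply: (set_mem (gen_valP x)); split.
  move=> _ _ [u Mu <-] [v Mv <-]; have [MI MU] := cM u v Mu Mv.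
  by split; [exists (u `&` v)%O; rewrite ?gen_valI
            |exists (u `|` v)%O; rewrite ?gen_valU].
move=> y Gy.
have Py : y \in generated_pred by apply/mem_set; exact: sub_gen_smallest.
by exists (GeneratedLattice Py) => //; apply: GM.
Qed.

Lemma gen_val_embedding : lattice_embedding gen_val.
Proof. by split; [exact: val_inj | exact: gen_valI | exact: gen_valU]. Qed.

End GeneratedSublattice.

Lemma generated_lattice_three_generated d (L : latticeType d) (a b c : L) :
  three_generated (generated_lattice [set a; b; c]).
Proof.
have inG x : [set a; b; c] x -> x \in generated_pred [set a; b; c].
  by move=> Gx; apply/mem_set; exact: sub_gen_smallest.
have Ga : [set a; b; c] a by left; left.
have Gb : [set a; b; c] b by left; right.
have Gc : [set a; b; c] c by right.
exists (GeneratedLattice (inG a Ga)), (GeneratedLattice (inG b Gb)),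
  (GeneratedLattice (inG c Gc)).
rewrite /generates -(generates_generated [set a; b; c]); congr (smallest _ _).
apply/seteqP; split=> x /=.
  by move=> [[->|->]|->].
by move=> [[/= E|/= E]|/= E]; [left; left|left; right|right]; exact: val_inj.
Qed.

(** * Length of a poset *)

(** A strictly monotone rank is injective on chains, so a chain has at most as
    many elements as there are ranks. *)
Lemma rank_poset_length d (P : porderType d) (r : P -> nat) (n : nat) :
    {homo r : x y / (x < y)%O >-> x < y} -> (forall x, r x <= n) ->
  (poset_length P <= (Posz n)%:E)%O.
Proof.
move=> r_lt r_le; apply/poset_length_le => C cC.
have rI : {in C &, injective r}.
  move=> x y xC yC rxy; have := cC x y xC yC.
  by case: comparableP => // /r_lt; rewrite rxy ltnn.
rewrite -(card_in_imfset imfset_key rI) -(size_iota 0 n.+1).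
apply: uniq_leq_size; first exact: fset_uniq.
by move=> _ /imfsetP[x _ ->]; rewrite mem_iota ltnS r_le.
Qed.

(** * The fence between two poles *)

Inductive fence := Pole of bool | Node of nat.

Definition fence_to_sum (x : fence) : bool + nat :=
  match x with Pole b => inl b | Node n => inr n end.

Definition sum_to_fence (x : bool + nat) : fence :=
  match x with inl b => Pole b | inr n => Node n end.

Lemma fence_to_sumK : cancel fence_to_sum sum_to_fence.
Proof. by case. Qed.

HB.instance Definition _ := Choice.copy fence (can_type fence_to_sumK).

(** The poles [Pole false] and [Pole true] are the bottom and the top, and each
    odd node lies below its two even neighbours. *)
Definition fence_lt (x y : fence) : bool :=
  match x, y with
  | Pole b, Pole c => ~~ b && c
  | Pole b, Node _ => ~~ b
  | Node _, Pole c => c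
  | Node m, Node n => odd m && ((m == n.+1) || (n == m.+1))
  end.

Lemma fence_lt_irr : irreflexive fence_lt.
Proof. by case=> [[]|n] //=; lia. Qed.

Lemma fence_lt_trans : transitive fence_lt.
Proof. by case=> [b|n] [c|m] [e|p] //=; lia. Qed.

HB.instance Definition _ :=
  Order.Lt_isPOrder.Build (Order.Disp tt tt) fence
    fence_lt_irr fence_lt_trans.

Lemma fence_ltE (x y : fence) : (x < y)%O = fence_lt x y.
Proof. by []. Qed.

Definition fence_rank (x : fence) : nat :=
  match x with Pole b => 3 * b | Node n => 2 - odd n end.

Lemma fence_poset_length : (poset_length fence <= (Posz 3)%:E)%O.
Proof.
apply: (@rank_poset_length _ _ fence_rank) => [x y|[b|n] /=]; last 2 first.
- by case: b.
- lia.
by rewrite fence_ltE; case: x y => [b|n] [c|m] /=; lia.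
Qed.

(** Convexity only has to be tested on strict inequalities, on which
    [fence_lt] computes. *)
Lemma fence_convexP (X : set fence) :
  (forall x y z, X x -> X y -> fence_lt x z -> fence_lt z y -> X z) ->
  order_convex X.
Proof.
move=> cX x y z Xx Xy; rewrite !le_eqVlt.
move=> /predU1P[<- //|xz] /predU1P[-> //|zy]; exact: cX xz zy.
Qed.

Definition bottom_set : set fence := [set Pole false].
Definition top_set : set fence := [set Pole true; Node 0].
Definition node_set : set fence := range Node.

Lemma bottom_convex : order_convex bottom_set.
Proof. by apply: fence_convexP => x y [b|n] -> -> /=; lia. Qed.

Lemma top_convex : order_convex top_set.
Proof.
by apply: fence_convexP => x y [b|n] [->|->] [->|->] //=; lia.
Qed.

Lemma node_convex : order_convex node_set.
Proof.
apply: fence_convexP => _ _ [b|n] [k _ <-] [l _ <-] /=; last by exists n.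
lia.
Qed.

Definition bottom_co := MkCo (mem_set bottom_convex).
Definition top_co := MkCo (mem_set top_convex).
Definition node_co := MkCo (mem_set node_convex).

(** * Climbing the fence *)

(** Defined in any lattice, so that its values visibly lie in the sublattice
    generated by [a], [b] and [c]. *)
Fixpoint climb d (L : latticeType d) (a b c : L) (k : nat) : L :=
  if k is j.+1 then ((climb a b c j `|` if odd j then b else a) `&` c)%O
  else (b `&` c)%O.

Lemma climb_generated d (L : latticeType d) (a b c : L) k :
  generated [set a; b; c] (climb a b c k).
Proof.
have sub_gen := @sub_gen_smallest _ (@sublattice d L) [set a; b; c].
have Ga : generated [set a; b; c] a by apply: sub_gen; left; left.
have Gb : generated [set a; b; c] b by apply: sub_gen; left; right.
have Gc : generated [set a; b; c] c by apply: sub_gen; right.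
elim: k => [|k IHk] /=; first by have [] := generated_sublattice Gb Gc.
have Gs : generated [set a; b; c] (if odd k then b else a) by case: ifP.
have [_ Gj] := generated_sublattice IHk Gs.
by have [] := generated_sublattice Gj Gc.
Qed.

(** An order-convex bound for the join formed at step k: the pole used there
    together with the first k + 2 nodes. *)
Definition climb_hull (k : nat) : set fence :=
  [set x | match x with Pole b => b = odd k | Node m => m <= k.+1 end].

(** Only one node outside the hull is adjacent in the fence to a node of the
    hull: w_{k+2}, adjacent to w_{k+1}. It has the parity of k, so it lies
    between w_{k+1} and the pole that is left out of the hull; hence it is not
    between two elements of the hull. *)
Lemma climb_hull_convex k : order_convex (climb_hull k).
Proof.
apply: fence_convexP => -[b|n] [c|m] [e|p] /=; lia.
Qed.

(** The join formed at step k stays inside [climb_hull k], which bounds its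
    nodes by k + 1. Conversely w_{k+1} belongs to it, being between w_k and the
    pole used at that step. *)
Lemma climbE k :
  Co_set (climb bottom_co top_co node_co k) =
  [set Node m | m in [set m | m <= k]].
Proof.
elim: k => [|k IHk] /=.
  apply/seteqP; split=> x /=.
    by move=> [[-> [] //|->] _]; exists 0.
  by move=> [m]; rewrite leqn0 => /eqP -> <-; split; [right|exists 0].
rewrite IHk; apply/seteqP; split=> x /=.
  move=> [Jx [m _ mx]]; exists m => //; rewrite -mx in Jx.
  apply: (Jx (climb_hull k)); split; first exact: climb_hull_convex.
  move=> y [[n /= nk <-] /=|]; first by lia.
  by case: ifP => [ko [->|->]|ko ->] /=; rewrite ?ko.
move=> [m mk <-]; split; last by exists m.
have [{}mk|km] := leqP m k.
  by apply: sub_gen_smallest; left; exists m.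
have {mk km} -> : m = k.+1 by lia.
move=> M [cM sM].
have Mk : M (Node k) by apply: sM; left; exists k => /=.
have Mp : M (Pole (odd k)).
  by apply: sM; right; case: ifP => ko //=; left.
have [ko|ke] := boolP (odd k).
  rewrite ko in Mp.
  by apply: (cM _ _ _ Mk Mp); apply: ltW; rewrite fence_ltE /= ?ko ?eqxx ?orbT.
rewrite (negbTE ke) in Mp.
by apply: (cM _ _ _ Mp Mk); apply: ltW; rewrite fence_ltE /= ?ke ?eqxx ?orbT.
Qed.

Lemma climb_inj : injective (climb bottom_co top_co node_co).
Proof.
have le i j : climb bottom_co top_co node_co i =
    climb bottom_co top_co node_co j -> i <= j.
  move=> /(congr1 (@Co_set _ _)); rewrite !climbE => E.
  have : [set Node m | m in [set m | m <= i]] (Node i) by exists i => /=.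
  by rewrite E => -[m /= mj [<-]].
by move=> i j ij; apply/eqP; rewrite eqn_leq !le.
Qed.

Definition fence_lattice := generated_lattice [set bottom_co; top_co; node_co].

Lemma fence_lattice_SUB n : 3 <= n -> SUB n fence_lattice.
Proof.
move=> n3; exists _, fence, (@gen_val _ _ _).
split; last exact: gen_val_embedding.
by apply: le_trans fence_poset_length _; rewrite lee_fin.
Qed.

Lemma fence_lattice_infinite : infinite_set [set: fence_lattice].
Proof.
pose f k : fence_lattice :=
  GeneratedLattice (mem_set (@climb_generated _ _ bottom_co top_co node_co k)).
have fI : injective f by move=> i j /(congr1 (@gen_val _ _ _))/climb_inj.
move=> finL; apply: infinite_nat; rewrite -(preimage_setT f).
by apply: finite_preimage finL => i j _ _ /fI.
Qed.

Theorem theorem7p1 :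
  (exists (d : Order.disp_t) (L : latticeType d),
     [/\ SUB 3 L, three_generated L & infinite_set [set: L]]) /\
  (forall n : nat, 3 <= n -> ~ locally_finite (SUB n)).
Proof.
have three := generated_lattice_three_generated bottom_co top_co node_co.
split.
  exists _, fence_lattice; split=> //; first exact: fence_lattice_SUB.
  exact: fence_lattice_infinite.
move=> n n3 /(_ _ _ (fence_lattice_SUB n3)) fin.
apply: fence_lattice_infinite; apply: fin.
by have [a [b [c gen]]] := three; exists [set a; b; c].
Qed.
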